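(* Let $(\Gamma,\varphi)$, $\varphi:\Gamma\to\mathbb{R}^d$, be a superabundant parametrised tropical curve of genus $g$ with $d>g$. Then there exists a projection $\pi:\mathbb{R}^d\to\mathbb{R}^g$ (a surjective rational linear map) such that $(\Gamma,\pi\circ\varphi)$, perhaps after applying a rational dilation to $\Gamma$, is superabundant.
   Context: An abstract tropical curve $\Gamma=(G,m,\ell)$ consists of a finite graph $G$, a marking function $m:\{1,\dots,n\}\to V(G)$ and a length function $\ell:E(G)\to\mathbb{R}_{>0}$. It is regarded as a metric space: each edge $e$ is a segment of length $\ell(e)$, and for each $i$ a half-line $\mathbb{R}_{\ge0}$ (a leg) is glued at $0$ to $m(i)$. The genus is the first Betti number of $G$. A parametrised tropical curve is a pair $(\Gamma,\varphi)$ with $\varphi:\Gamma\to\mathbb{R}^r$ continuous, affine linear with integer slope on each edge and leg, and balanced: at every point of $\Gamma$ the sum of the outgoing directional derivatives of $\varphi$ is $0$. Superabundancy. Let $(\Gamma,\varphi)$ have genus $g$ and $b$ bounded edges, in $\mathbb{R}^r$; orient the edges and let $w_e\in\mathbb{Z}^r$ be the slope along $e$. The deformation space modulo translations is the cone of $(\ell_e)\in\mathbb{R}_{>0}^{E(G)}$ with $\sum_e a_e\ell_e w_e=0$ for every cycle $\sum_e a_e[e]\in H_1(G,\mathbb{Z})$. $(\Gamma,\varphi)$ is superabundant if the dimension of this cone is greater than $b-rg$. A rational dilation of $\Gamma$ multiplies the lengths of edges (and rescales legs) by positive rational numbers, giving a homeomorphic curve with a different metric; it is used to make the slopes of $\pi\circ\varphi$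 integral. *)

(* Defs.v *)
From HB Require Import structures.
From mathcomp Require Import all_boot all_order all_algebra.
From mathcomp Require Import all_classical all_reals all_analysis.

Set Implicit Arguments.
Unset Strict Implicit.
Unset Printing Implicit Defensive.

Import Order.TTheory GRing.Theory Num.Theory.
Import numFieldNormedType.Exports.

Local Open Scope classical_set_scope.
Local Open Scope ring_scope.

(* Loops and multiple edges are allowed.  The source and target of an edge
   fix an auxiliary orientation. *)
Record graph := Graph {
  vertex : finType;
  edge : finType;
  src : edge -> vertex;
  tgt : edge -> vertex }.

Definition boundary (G : graph) (A : zmodType) (a : {ffun edge G -> A}) :
    {ffun vertex G -> A} :=
  [ffun v => \sum_(e | tgt e == v) a e - \sum_(e | src e == v) a e].

Lemma boundary_linear (G : graph) (F : fieldType) :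
  linear (@boundary G F^o).
Proof.
move=> k a b; apply/ffunP => v; rewrite !ffunE scalerBr !scaler_sumr.
rewrite addrACA -opprD -!big_split /=.
by congr (_ - _); apply: eq_bigr => e _; rewrite !ffunE.
Qed.

(* As G has no 2-cells, H_1(G, Z) is the kernel of the boundary map. *)
Definition is_cycle (G : graph) (a : {ffun edge G -> int}) : Prop :=
  boundary a = 0.

(* The first Betti number, as the dimension of H_1(G, Q); linfun represents the
   boundary map faithfully by boundary_linear. *)
Definition betti1 (G : graph) : nat :=
  \dim (lker (linfun (@boundary G rat^o))).

Record tropical_curve (R : realType) (n : nat) := TropicalCurve {
  curve_graph :> graph;
  mark : 'I_n -> vertex curve_graph;
  len : edge curve_graph -> R;
  len_gt0 : forall e, 0 < len e }.

Definition genus (R : realType) (n : nat) (Gam : tropical_curve R n) : nat :=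
  betti1 Gam.

(* The underlying set of the metric space: the vertices, the interiors of the
   edges, with the arc length from the source as coordinate, and the legs with
   their end vertex removed. *)
Variant curve_point (R : realType) (n : nat) (Gam : tropical_curve R n) : Type :=
  | Vertex of vertex Gam
  | EdgePoint (e : edge Gam) of {t : R | 0 < t < len e}
  | LegPoint (i : 'I_n) of {t : R | 0 < t}.

Arguments Vertex {R n Gam}.
Arguments EdgePoint {R n Gam}.
Arguments LegPoint {R n Gam}.

(* The arc length parametrisations of the closed edge e by [0, len e] and of
   the closed leg i by [0, +oo[; the values for other t are irrelevant. *)
Definition edge_param (R : realType) (n : nat) (Gam : tropical_curve R n)
    (e : edge Gam) (t : R) : curve_point Gam :=
  if insub t is Some s then EdgePoint e s
  else if t <= 0 then Vertex (src e) else Vertex (tgt e).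

Definition leg_param (R : realType) (n : nat) (Gam : tropical_curve R n)
    (i : 'I_n) (t : R) : curve_point Gam :=
  if insub t is Some s then LegPoint i s else Vertex (mark Gam i).

(* A finite union of segments and half-lines glued at end points carries the
   quotient topology, so continuity is tested on the closed cells. *)
Definition continuous_on_curve (R : realType) (n : nat)
    (Gam : tropical_curve R n) (r : nat)
    (phi : curve_point Gam -> 'rV[R]_r) : Prop :=
  (forall e : edge Gam,
     {within `[0, len e], continuous (phi \o edge_param e)}) /\
  (forall i : 'I_n,
     {within `[0, +oo[, continuous (phi \o @leg_param R n Gam i)}).

(* w e is the slope along e from source to target, u i the slope along the
   leg i away from its vertex.  A loop at v leaves v in two directions. *)
Definition sum_outgoing_slopes (R : realType) (n : nat)
    (Gam : tropical_curve R n) (r : nat)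
    (w : edge Gam -> 'rV[int]_r) (u : 'I_n -> 'rV[int]_r)
    (p : curve_point Gam) : 'rV[int]_r :=
  match p with
  | Vertex v => \sum_(e | src e == v) w e + \sum_(e | tgt e == v) (- w e)
                + \sum_(i | mark Gam i == v) u i
  | EdgePoint e _ => w e + - w e
  | LegPoint i _ => u i + - u i
  end.

(* The slopes are determined by phi, since edges and legs have positive
   length. *)
Record parametrisation (R : realType) (n : nat) (Gam : tropical_curve R n)
    (r : nat) := Parametrisation {
  pmap :> curve_point Gam -> 'rV[R]_r;
  edge_slope : edge Gam -> 'rV[int]_r;
  leg_slope : 'I_n -> 'rV[int]_r;
  pmap_continuous : continuous_on_curve pmap;
  pmap_edge : forall (e : edge Gam) (t : R), 0 <= t <= len e ->
    pmap (edge_param e t)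
      = pmap (Vertex (src e)) + t *: map_mx intr (edge_slope e);
  pmap_leg : forall (i : 'I_n) (t : R), 0 <= t ->
    pmap (leg_param Gam i t)
      = pmap (Vertex (mark Gam i)) + t *: map_mx intr (leg_slope i);
  pmap_balanced : forall p : curve_point Gam,
    sum_outgoing_slopes edge_slope leg_slope p = 0 }.

Definition deformation_cone (R : realType) (n : nat)
    (Gam : tropical_curve R n) (r : nat) (phi : parametrisation Gam r) :
    set {ffun edge Gam -> R^o} :=
  [set l | (forall e, 0 < l e) /\
     forall a : {ffun edge Gam -> int}, is_cycle a ->
       \sum_e ((a e)%:~R * l e) *: map_mx intr (edge_slope phi e)
         = 0 :> 'rV[R]_r].

Definition is_linear_span (R : fieldType) (V : vectType R) (C : set V)
    (U : {vspace V}) : Prop :=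
  (forall x, C x -> x \in U) /\
  (forall W : {vspace V}, (forall x, C x -> x \in W) -> (U <= W)%VS).

(* The dimension of a cone is that of its linear span.  The comparison is made
   in int because b - r g may be negative. *)
Definition superabundant (R : realType) (n : nat) (Gam : tropical_curve R n)
    (r : nat) (phi : parametrisation Gam r) : Prop :=
  exists2 U : {vspace {ffun edge Gam -> R^o}},
    is_linear_span (deformation_cone phi) U &
    #|edge Gam|%:Z - r%:Z * (genus Gam)%:Z < (\dim U)%:Z.

Record dilation (R : realType) (n : nat) (Gam : tropical_curve R n) :=
  Dilation {
    edge_factor : edge Gam -> rat;
    leg_factor : 'I_n -> rat;
    edge_factor_gt0 : forall e, 0 < edge_factor e;
    leg_factor_gt0 : forall i, 0 < leg_factor i }.

Section Dilate.
Variables (R : realType) (n : nat) (Gam : tropical_curve R n).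
Variable c : dilation Gam.

Lemma dilate_len_gt0 (e : edge Gam) : 0 < ratr (edge_factor c e) * len e.
Proof. by rewrite mulr_gt0 ?len_gt0 // ltr0q edge_factor_gt0. Qed.

Definition dilate : tropical_curve R n :=
  TropicalCurve (@mark R n Gam) dilate_len_gt0.

Lemma dilate_edge_coord (e : edge Gam) (s : {t : R | 0 < t < len e}) :
  0 < ratr (edge_factor c e) * val s < ratr (edge_factor c e) * len e.
Proof.
have c0 : 0 < ratr (edge_factor c e) :> R by rewrite ltr0q edge_factor_gt0.
by case: s => t /= /andP[t0 tl]; rewrite mulr_gt0 //= ltr_pM2l.
Qed.

Lemma dilate_leg_coord (i : 'I_n) (s : {t : R | 0 < t}) :
  0 < ratr (leg_factor c i) * val s.
Proof. by case: s => t /= t0; rewrite mulr_gt0 // ltr0q leg_factor_gt0. Qed.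

(* The canonical homeomorphism from the curve to its dilation. *)
Definition dilate_point (p : curve_point Gam) : curve_point dilate :=
  match p with
  | Vertex v => @Vertex R n dilate v
  | EdgePoint e s => @EdgePoint R n dilate e
      (exist (fun t => is_true (0 < t < ratr (edge_factor c e) * len e))
         _ (dilate_edge_coord s))
  | LegPoint i s => @LegPoint R n dilate i
      (exist (fun t => is_true (0 < t)) _ (dilate_leg_coord i s))
  end.

End Dilate.

(* The rational linear map R^d -> R^k with matrix A, acting on row vectors. *)
Definition rational_map (R : realType) (d k : nat) (A : 'M[rat]_(d, k))
    (x : 'rV[R]_d) : 'rV[R]_k := x *m map_mx ratr A.

(* Main.v *)
Require Import Defs.
From HB Require Import structures.
From mathcomp Require Import all_boot all_order all_algebra.
From mathcomp Require Import all_classical all_reals all_analysis.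

(** Write [g] for the genus, [b] for the number of edges and [w_e] for the
    slopes of a curve in [R^r].  Choose [g] integral cycles that span [H_1(G, Q)] and let
    [z_e] be the column of their coefficients at the edge [e].  The cycle
    conditions on lengths [l] then form one linear equation
    [\sum_e l_e z_e w_e = 0] between [g x r] matrices.  The lengths of the curve
    itself satisfy it, and are positive, so the deformation cone spans its
    whole solution space, of dimension [b] minus the dimension of the span of
    the matrices [z_e w_e].  Hence the curve is superabundant exactly when these
    matrices do not span all [g x r] matrices.  Since they have integral
    entries, this means that there is a nonzero rational [g x r] matrix [X]
    orthogonal to all of them: [tr (X^T z_e w_e) = 0] for every [e]
    ([superabundantP]).

    Let now [r = d > g].  The [g] rows of [X] lie in a [g]-dimensional rational
    subspace, so [X = Y B] with [B] a [g x d] matrix of rank [g]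
    ([factor_full_rank]).  A multiple of [B^T] is an integral matrix [N], which
    is of rank [g] and therefore defines a surjection; it sends the slopes [w_e]
    to the integral slopes [w_e N], so that no actual change of lengths is
    needed ([compose_integral]).  Finally [tr (Y^T z_e w_e N)] is a multiple of
    [tr (X^T z_e w_e) = 0], and [Y] is nonzero because [X] is: the matrix [Y]
    shows that the projected curve is superabundant. *)

Set Implicit Arguments.
Unset Strict Implicit.
Unset Printing Implicit Defensive.

Import Order.TTheory GRing.Theory Num.Theory.
Import numFieldNormedType.Exports.

Local Open Scope ring_scope.

(** * Linear relations between matrices *)

(** [\tr (X^T *m Y)] is the standard bilinear form on matrices. *)
Lemma mxtrace_mxvec (F : comNzRingType) (m n : nat) (X Y : 'M[F]_(m, n)) :
  \tr (X^T *m Y) = (mxvec X *m (mxvec Y)^T) 0 0.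
Proof.
rewrite /mxtrace mxE (eq_bigr (fun j => \sum_i X i j * Y i j)); last first.
  by move=> j _; rewrite mxE; apply: eq_bigr => i _; rewrite mxE.
rewrite exchange_big pair_bigA /=.
rewrite (reindex (uncurry (@mxvec_index m n))) /=; last first.
  exact: curry_mxvec_bij.
by apply: eq_bigr => -[i j] _ /=; rewrite !mxE !mxvecE.
Qed.

(** The linear combination of the matrices [t i] with coefficients [l i]. *)
Definition lin_comb (F : fieldType) (I : finType) (m n : nat)
    (t : I -> 'M[F]_(m, n)) (l : {ffun I -> F^o}) : 'M[F]_(m, n) :=
  \sum_i l i *: t i.

Lemma lin_comb_is_linear (F : fieldType) (I : finType) (m n : nat)
  (t : I -> 'M[F]_(m, n)) : linear (lin_comb t).
Proof.
move=> k a b; rewrite /lin_comb scaler_sumr -big_split /=.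
by apply: eq_bigr => i _; rewrite !ffunE scalerDl scalerA.
Qed.

HB.instance Definition _ (F : fieldType) (I : finType) (m n : nat)
    (t : I -> 'M[F]_(m, n)) :=
  GRing.isLinear.Build F {ffun I -> F^o} 'M[F]_(m, n) *:%R (lin_comb t)
    (lin_comb_is_linear t).

(** The space of linear relations between the matrices [t i]. *)
Definition relations (F : fieldType) (I : finType) (m n : nat)
    (t : I -> 'M[F]_(m, n)) : {vspace {ffun I -> F^o}} :=
  lker (linfun (lin_comb t)).

Lemma mem_relations (F : fieldType) (I : finType) (m n : nat)
    (t : I -> 'M[F]_(m, n)) l : (l \in relations t) = (lin_comb t l == 0).
Proof. by rewrite memv_ker lfunE. Qed.

Lemma dim_relations (F : fieldType) (I : finType) (m n : nat)
    (t : I -> 'M[F]_(m, n)) :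
  (\dim (relations t) + \dim (limg (linfun (lin_comb t))) = #|I|)%N.
Proof.
have := limg_ker_dim (linfun (lin_comb t)) fullv.
by rewrite capfv dimvf /dim /= muln1.
Qed.

Lemma dim_mx (F : fieldType) (m n : nat) :
  \dim {: 'M[F]_(m, n)} = (m * n)%N.
Proof. by rewrite dimvf. Qed.

(** Matrices defined over a subfield [F] of [K] have more relations over [K]
    than forced by the dimension of the matrix space exactly when they fail to span
    it, and this is witnessed by an orthogonal matrix over [F]. *)
Lemma dim_relations_gt (F K : fieldType) (f : {rmorphism F -> K})
    (I : finType) (m n : nat) (t : I -> 'M[F]_(m, n)) :
  (#|I| < \dim (relations (fun i => map_mx f (t i))) + m * n)%N <->
  exists2 X : 'M[F]_(m, n), X != 0 & forall i, \tr (X^T *m t i) = 0.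
Proof.
pose tf i := map_mx f (t i); rewrite -{1}(dim_relations tf) ltn_add2l.
split=> [lt_dim | [X X0 trX]].
- (* The rows of M are the t i.  If M has full column rank, a left inverse N of
     M writes every matrix over K as a combination of the t i, against lt_dim;
     otherwise a nonzero column of the cokernel is the required X. *)
  pose M : 'M[F]_(#|I|, m * n) := \matrix_k mxvec (t (enum_val k)).
  have [|] := boolP (cokermx M == 0).
    rewrite cokermx_eq0 => /row_fullP[N NM]; exfalso.
    suff full : limg (linfun (lin_comb tf)) = fullv.
      by move: lt_dim; rewrite full dim_mx ltnn.
    apply/vspaceP => y; rewrite memvf; apply/memv_imgP.
    exists [ffun i => (mxvec y *m map_mx f N) 0 (enum_rank i)].
      exact: memvf.
    rewrite lfunE /= /lin_comb; apply: (can_inj mxvecK).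
    rewrite linear_sum /= -[LHS]mulmx1 -(map_mx1 f) -NM map_mxM mulmxA.
    rewrite mulmx_sum_row (reindex (@enum_rank I)) /=; last first.
      by apply: onW_bij; apply: enum_rank_bij.
    apply: eq_bigr => i _; rewrite ffunE linearZ /=; congr (_ *: _).
    by rewrite -map_row rowK enum_rankK map_mxvec.
  move=> C0; have [j Cj] : exists j, col j (cokermx M) != 0.
    apply/existsP; apply: contraNT C0; rewrite negb_exists => /forallP C0.
    apply/eqP/matrixP => i j; have /eqP/colP/(_ i) := negbNE (C0 j).
    by rewrite !mxE.
  exists (vec_mx (col j (cokermx M))^T).
    rewrite -(inj_eq (can_inj (@mxvecK _ m n))) vec_mxK linear0.
    by rewrite -(inj_eq (@trmx_inj _ _ _)) trmxK trmx0.
  move=> i; rewrite mxtrace_mxvec vec_mxK -trmx_mul mxE.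
  have <- : row (enum_rank i) M = mxvec (t i) by rewrite rowK enum_rankK.
  by rewrite -row_mul colE mulmxA mulmx_coker mul0mx !mxE.
- rewrite -(dim_mx K) ltn_neqAle dimvS ?subvf // andbT.
  rewrite (dimv_leqif_eq (subvf _)); apply/eqP => full.
  have [/= i [j Xij]] : exists i, exists j, X i j != 0.
    have [//|X00] := EM (exists i, exists j, X i j != 0).
    case/eqP: X0; apply/matrixP => i j; rewrite mxE; apply/eqP.
    by apply/negPn/negP => Xij; apply: X00; exists i, j.
  have : delta_mx i j \in limg (linfun (lin_comb tf)) by rewrite full memvf.
  (* Were delta_mx i j a combination of the t k, pairing it with X would give
     X i j = 0. *)
  case/memv_imgP => l _; rewrite lfunE /= /lin_comb => dl.
  have := congr1 (fun Y => \tr ((map_mx f X)^T *m Y)) dl.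
  rewrite mulmx_sumr linear_sum /= big1 => [|k _].
    rewrite mxtrace_mxvec mxvec_delta trmx_delta -colE mxE mxvecE mxE.
    by move/eqP; rewrite fmorph_eq0 (negPf Xij).
  by rewrite -scalemxAr linearZ /= map_trmx -map_mxM trace_map_mx trX rmorph0
    mulr0.
Qed.

(** * Clearing denominators *)

Lemma clear_denominators (I : finType) (q : I -> rat) :
  exists (D : int) (p : I -> int),
    D != 0 /\ forall i, (p i)%:~R = D%:~R * q i.
Proof.
exists (\prod_i denq (q i)).
exists (fun i => numq (q i) * \prod_(j | j != i) denq (q j)).
split=> [|i]; first by apply/prodf_neq0 => i _; exact: denq_neq0.
rewrite [in RHS](bigD1 i) //= !intrM mulrAC; congr (_ * _).
by rewrite numqE mulrC.
Qed.

Lemma clear_denominators_mx (m n : nat) (A : 'M[rat]_(m, n)) :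
  exists (D : int) (N : 'M[int]_(m, n)),
    D != 0 /\ map_mx intr N = D%:~R *: A.
Proof.
have [D [p [D0 pE]]] := clear_denominators (fun ij => A ij.1 ij.2).
exists D, (\matrix_(i, j) p (i, j)); split=> //.
by apply/matrixP => i j; rewrite !mxE pE.
Qed.

(** When [m <= n], the row space of [X] lies in some [m]-dimensional space,
    spanned by the rows of [B]. *)
Lemma factor_full_rank (F : fieldType) (m n : nat) (X : 'M[F]_(m, n)) :
  (m <= n)%N ->
  exists (Y : 'M[F]_m) (B : 'M[F]_(m, n)), X = Y *m B /\ \rank B = m.
Proof.
move=> le_mn; exists (col_ebase X *m pid_mx (\rank X)).
exists (pid_mx m *m row_ebase X); split.
  rewrite mulmxA -(mulmxA (col_ebase X)) mul_pid_mx.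
  rewrite (minn_idPl (rank_leq_row X)) (minn_idPr (rank_leq_row X)).
  by rewrite mulmx_ebase.
rewrite mxrankMfree ?row_free_unit ?row_ebase_unit //.
by rewrite rank_pid_mx.
Qed.

(** * Integral cycles *)

HB.instance Definition _ (G : graph) (F : fieldType) :=
  GRing.isLinear.Build F {ffun edge G -> F^o} {ffun vertex G -> F^o} *:%R
    (@boundary G F^o) (@boundary_linear G F).

(** An integral chain, seen as a rational one. *)
Definition rat_chain (G : graph) (a : {ffun edge G -> int}) :
    {ffun edge G -> rat^o} := [ffun e => (a e)%:~R].

Lemma boundary_rat_chain (G : graph) (a : {ffun edge G -> int}) v :
  boundary (rat_chain a) v = (boundary a v)%:~R.
Proof.
rewrite !ffunE rmorphB /= !rmorph_sum /=.
by congr (_ - _); apply: eq_bigr => e _; rewrite ffunE.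
Qed.

Lemma is_cycleE (G : graph) (a : {ffun edge G -> int}) :
  is_cycle a <-> boundary (rat_chain a) = 0.
Proof.
split=> [a0 | a0]; apply/ffunP => v.
  by rewrite boundary_rat_chain a0 !ffunE.
have /ffunP/(_ v) := a0; rewrite boundary_rat_chain !ffunE => /eqP.
by rewrite intr_eq0 => /eqP.
Qed.

(** The rows of [z], i.e. the integral chains [e |-> z e j 0], are cycles, and
    every integral cycle is a rational combination of them.  They are not
    required to be independent. *)
Definition generating (G : graph) (g : nat) (z : edge G -> 'cV[int]_g) : Prop :=
  (forall j, is_cycle [ffun e => z e j 0]) /\
  (forall a, is_cycle a -> exists q : 'rV[rat]_g,
     forall e, (a e)%:~R = (q *m map_mx intr (z e)) 0 0).

(** A basis of [H_1(G, Q)], with denominators cleared. *)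
Lemma generating_cycles (G : graph) :
  exists z : edge G -> 'cV[int]_(betti1 G), generating z.
Proof.
set H := lker (linfun (@boundary G rat^o)).
have HE x : (x \in H) = (boundary x == 0) by rewrite memv_ker lfunE.
have [D [p [D0 pE]]] := clear_denominators
  (fun je : 'I_(\dim H) * edge G => ((vbasis H)`_je.1 : {ffun _ -> _}) je.2).
exists (fun e => \col_j p (j, e)); split=> [j | a].
  apply/is_cycleE; have -> : rat_chain [ffun e => (\col_j p (j, e)) j 0] =
      D%:~R *: (vbasis H)`_j.
    by apply/ffunP => e; rewrite !ffunE !mxE pE.
  apply/eqP; rewrite -HE memvZ // vbasis_mem // mem_nth //.
  by rewrite size_tuple.
move/is_cycleE/eqP; rewrite -HE => /coord_vbasis aE.
exists (\row_j ((D%:~R)^-1 * coord (vbasis H) j (rat_chain a))) => e.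
rewrite mxE; have /ffunP/(_ e) := aE; rewrite ffunE => ->.
rewrite sum_ffunE; apply: eq_bigr => j _.
by rewrite ffunE !mxE pE mulrACA mulVf ?intr_eq0 // mul1r.
Qed.

(** * The deformation cone and superabundancy *)

(** The contribution of a unit length of [e] to the displacements along the [g]
    cycles given by [z], one in each row, as a rational matrix. *)
Definition cycle_slope (G : graph) (g r : nat) (z : edge G -> 'cV[int]_g)
    (w : edge G -> 'rV[int]_r) (e : edge G) : 'M[rat]_(g, r) :=
  map_mx intr (z e *m w e).

Lemma map_mx_ratr_intr (R : numFieldType) (m n : nat) (M : 'M[int]_(m, n)) :
  map_mx ratr (map_mx intr M : 'M[rat]_(m, n)) = map_mx intr M :> 'M[R]_(m, n).
Proof. by apply/matrixP => i j; rewrite !mxE ratr_int. Qed.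

Lemma cycle_conditionsE (R : realType) (G : graph) (g r : nat)
    (z : edge G -> 'cV[int]_g) (w : edge G -> 'rV[int]_r)
    (l : {ffun edge G -> R^o}) : generating z ->
  (forall a : {ffun edge G -> int}, is_cycle a ->
     \sum_e ((a e)%:~R * l e) *: map_mx intr (w e) = 0 :> 'rV[R]_r) <->
  l \in relations (fun e => map_mx ratr (cycle_slope z w e)).
Proof.
move=> [z_cycle z_gen]; rewrite mem_relations.
rewrite /lin_comb; under eq_bigr => e _ do rewrite map_mx_ratr_intr.
split=> [cond | /eqP l0 a /z_gen[q aE]].
  apply/eqP/matrixP => j k; have /rowP/(_ k) := cond _ (z_cycle j).
  rewrite summxE mxE => cond_jk; rewrite summxE mxE -[RHS]cond_jk.
  apply: eq_bigr => e _; rewrite ffunE !mxE big_ord1 intrM.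
  by rewrite mulrCA mulrA.
rewrite -[RHS](mulmx0 _ (map_mx ratr q)) -[in RHS]l0 mulmx_sumr.
apply: eq_bigr => e _.
rewrite map_mxM -scalemxAr mulmxA.
have -> : map_mx ratr q *m map_mx intr (z e) =
    map_mx ratr (q *m map_mx intr (z e)) :> 'M[R]_1.
  by rewrite map_mxM map_mx_ratr_intr.
rewrite [map_mx ratr _]mx11_scalar mul_scalar_mx scalerA mulrC mxE -aE.
by rewrite ratr_int.
Qed.

Lemma edge_param_tgt (R : realType) (n : nat) (Gam : tropical_curve R n)
    (e : edge Gam) : edge_param e (len e) = Vertex (tgt e).
Proof.
by rewrite /edge_param insubF ?ltxx ?andbF // leNgt len_gt0.
Qed.

(** The displacement of [phi] along a cycle is zero. *)
Lemma len_deformation_cone (R : realType) (n r : nat)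
    (Gam : tropical_curve R n) (phi : parametrisation Gam r) :
  deformation_cone phi [ffun e => len e].
Proof.
split=> [e|a a_cycle]; first by rewrite ffunE len_gt0.
pose x v := phi (Vertex v).
have slopeE e :
    (len e : R) *: map_mx intr (edge_slope phi e) = x (tgt e) - x (src e).
  have := @pmap_edge _ _ _ _ phi e (len e).
  rewrite lexx ltW ?len_gt0 // => /(_ isT).
  by rewrite edge_param_tgt /x => ->; rewrite addrAC subrr add0r.
(* Summation by parts: regroup the increments of phi by vertices. *)
transitivity (\sum_v (boundary a v)%:~R *: x v); last first.
  by rewrite a_cycle big1 // => v _; rewrite ffunE scale0r.
transitivity (\sum_e (a e)%:~R *: x (tgt e) - \sum_e (a e)%:~R *: x (src e)).
  rewrite -sumrB; apply: eq_bigr => e _.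
  by rewrite ffunE -scalerA slopeE scalerBr.
under [RHS]eq_bigr => v _ do rewrite ffunE rmorphB /= scalerBl.
rewrite sumrB; congr (_ - _).
  rewrite (partition_big (@tgt Gam) xpredT) //=; apply: eq_bigr => v _.
  by rewrite rmorph_sum scaler_suml; apply: eq_bigr => e /eqP ->.
rewrite (partition_big (@src Gam) xpredT) //=; apply: eq_bigr => v _.
by rewrite rmorph_sum scaler_suml; apply: eq_bigr => e /eqP ->.
Qed.

(** A subspace that meets the open positive orthant is spanned by its positive
    vectors. *)
Lemma positive_span (R : realType) (I : finType) (W : {vspace {ffun I -> R^o}})
    (l0 : {ffun I -> R^o}) :
  l0 \in W -> (forall i, 0 < l0 i) ->
  is_linear_span
    [set l : {ffun I -> R^o} | (forall i, 0 < l i) /\ l \in W]%classic W.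
Proof.
move=> l0W l0_gt0; split=> [x [] //|V VP]; apply/subvP => x xW.
(* A multiple of l0 so large that x + N *: l0 is positive. *)
pose N := \sum_i `|x i| / l0 i + 1.
have l0V : l0 \in V by apply: VP.
suff : x + N *: l0 \in V.
  by move=> /(memvB)/(_ (memvZ N l0V)); rewrite addrK.
apply: VP; split; last by rewrite memvD ?memvZ.
move=> i; rewrite !ffunE.
have xN : `|x i| <= (\sum_i `|x i| / l0 i) * l0 i.
  rewrite -ler_pdivrMr // (bigD1 i) //= lerDl sumr_ge0 // => j _.
  by rewrite divr_ge0 // ltW.
have : - x i <= `|x i| by rewrite -normrN ler_norm.
rewrite /N /GRing.scale /= mulrDl mul1r => xi.
rewrite -(opprK (x i)) addrC subr_gt0 (le_lt_trans xi) //.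
by rewrite (le_lt_trans xN) // ltrDl.
Qed.

(** Superabundancy is the existence of a nonzero rational matrix orthogonal to
    the matrices [z e *m edge_slope phi e]. *)
Lemma superabundantP (R : realType) (n r : nat) (Gam : tropical_curve R n)
    (phi : parametrisation Gam r) (z : edge Gam -> 'cV[int]_(genus Gam)) :
  generating z ->
  superabundant phi <->
  exists2 X : 'M[rat]_(genus Gam, r), X != 0 &
    forall e, \tr (X^T *m cycle_slope z (edge_slope phi) e) = 0.
Proof.
move=> z_gen; rewrite -(dim_relations_gt (@ratr R)).
set W := relations _.
have coneE : deformation_cone phi =
    [set l : {ffun edge Gam -> R^o} | (forall e, 0 < l e) /\ l \in W]%classic.
  apply/seteqP; split=> l [l0 lW]; split=> //.
    by apply/(cycle_conditionsE _ _ z_gen).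
  by apply/(cycle_conditionsE _ _ z_gen).
have W_span : is_linear_span (deformation_cone phi) W.
  have := len_deformation_cone phi; rewrite {1}coneE => -[len0 lenW].
  by rewrite coneE; apply: positive_span lenW len0.
have dimE : (#|edge Gam|%:Z - r%:Z * (genus Gam)%:Z < (\dim W)%:Z) =
    (#|edge Gam| < \dim W + genus Gam * r)%N.
  by rewrite ltrBlDr -PoszM -PoszD ltz_nat mulnC.
split=> [[U [U1 U2]] | ltW]; last by exists W => //; rewrite dimE.
rewrite -dimE => /lt_le_trans; apply; rewrite lez_nat dimvS //.
by apply: U2; case: W_span.
Qed.

(** * Parametrisations and integral linear maps *)

Lemma edge_param_val (R : realType) (n : nat) (Gam : tropical_curve R n)
    (e : edge Gam) (s : {t : R | 0 < t < len e}) :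
  edge_param e (val s) = EdgePoint e s.
Proof. by rewrite /edge_param valK. Qed.

Lemma leg_param_val (R : realType) (n : nat) (Gam : tropical_curve R n)
    (i : 'I_n) (s : {t : R | 0 < t}) :
  leg_param Gam i (val s) = LegPoint i s.
Proof. by rewrite /leg_param valK. Qed.

Lemma affine_continuous (R : realType) (r : nat) (x w : 'rV[R]_r) :
  continuous (fun t : R => x + t *: w).
Proof.
move=> t; apply: cvgD; first exact: cvg_cst.
exact: scalel_continuous.
Qed.

(** Images of the vertices and slopes define a parametrisation as soon as they
    are compatible along each edge and balanced at each vertex. *)
Lemma parametrisation_exists (R : realType) (n r : nat)
    (Gam : tropical_curve R n) (x : vertex Gam -> 'rV[R]_r)
    (w : edge Gam -> 'rV[int]_r) (u : 'I_n -> 'rV[int]_r) :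
  (forall e, x (tgt e) = x (src e) + (len e : R) *: map_mx intr (w e)) ->
  (forall v, sum_outgoing_slopes w u (@Vertex R n Gam v) = 0) ->
  exists psi : parametrisation Gam r,
    [/\ forall v, psi (Vertex v) = x v,
        edge_slope psi = w & leg_slope psi = u].
Proof.
move=> x_tgt bal.
pose f (p : curve_point Gam) := match p with
  | Vertex v => x v
  | EdgePoint e s => x (src e) + (val s) *: map_mx intr (w e)
  | LegPoint i s => x (mark Gam i) + (val s) *: map_mx intr (u i)
  end.
have f_edge e (t : R) : 0 <= t <= len e ->
    f (edge_param e t) = x (src e) + t *: map_mx intr (w e).
  move=> /andP[t0 tl]; rewrite /edge_param; case: insubP => [s _ <- //|].
  rewrite negb_and -!leNgt; have [t_le0 _ | t_gt0 /= lt] := leP t 0.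
    have -> : t = 0 by apply/le_anti; rewrite t_le0 t0.
    by rewrite /= scale0r addr0.
  have -> : t = len e by apply/le_anti; rewrite tl lt.
  by rewrite -x_tgt.
have f_leg i (t : R) : 0 <= t ->
    f (leg_param Gam i t) = x (mark Gam i) + t *: map_mx intr (u i).
  move=> t0; rewrite /leg_param; case: insubP => [s _ <- //|].
  rewrite -leNgt => t_le0; have -> : t = 0 by apply/le_anti; rewrite t_le0 t0.
  by rewrite /= scale0r addr0.
have f_cont : continuous_on_curve f.
  split=> [e | i].
    apply: (subspace_eq_continuous _ (continuous_subspaceT
      (@affine_continuous _ _ (x (src e)) (map_mx intr (w e))))) => t.
    by rewrite inE /= in_itv /= => t_in; exact: esym (f_edge e t t_in).
  apply: (subspace_eq_continuous _ (continuous_subspaceT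
    (@affine_continuous _ _ (x (mark Gam i)) (map_mx intr (u i))))) => t.
  by rewrite inE /= in_itv /= andbT => t_in; exact: esym (f_leg i t t_in).
have f_bal (p : curve_point Gam) : sum_outgoing_slopes w u p = 0.
  by case: p => [v|e s|i s]; [exact: bal | exact: subrr | exact: subrr].
by exists (Parametrisation f_cont f_edge f_leg f_bal).
Qed.

(** The dilation with all factors 1; the new lengths [ratr 1 * len e] are equal
    to the old ones, but not by definition. *)
Definition unit_dilation (R : realType) (n : nat) (Gam : tropical_curve R n) :
    dilation Gam :=
  @Dilation R n Gam (fun=> 1) (fun=> 1) (fun=> ltr01) (fun=> ltr01).

(** An integral matrix maps integral slopes to integral slopes, so it can be
    composed with [phi] without changing the lengths. *)
Lemma compose_integral (R : realType) (n d k : nat) (Gam : tropical_curve R n)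
    (phi : parametrisation Gam d) (N : 'M[int]_(d, k)) :
  exists psi : parametrisation (dilate (unit_dilation Gam)) k,
    (forall p, psi (dilate_point (unit_dilation Gam) p) =
       rational_map (map_mx intr N) (phi p)) /\
    (forall e, edge_slope psi e = edge_slope phi e *m N).
Proof.
set pi := rational_map _.
have piE x (t : R) (w : 'rV[int]_d) : pi (x + t *: map_mx intr w) =
    pi x + t *: map_mx intr (w *m N).
  by rewrite /pi /rational_map mulmxDl -scalemxAl map_mx_ratr_intr map_mxM.
case: (@parametrisation_exists R n k (dilate (unit_dilation Gam))
  (fun v => pi (phi (@Vertex R n Gam v))) (fun e => edge_slope phi e *m N)
  (fun i => leg_slope phi i *m N)).
- move=> e; rewrite /= rmorph1 mul1r -piE -edge_param_tgt pmap_edge //.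
  by rewrite lexx ltW ?len_gt0.
- move=> v; have := pmap_balanced phi (@Vertex R n Gam v); rewrite /= => bal.
  rewrite -[RHS](mul0mx _ N) -[in RHS]bal !mulmxDl !mulmx_suml.
  by congr (_ + _ + _); apply: eq_bigr => e _; rewrite mulNmx.
move=> psi [psiV psiE psiL]; exists psi; split=> [|e]; last by rewrite psiE.
case=> [v | e [t t_in] | i [t t_in]]; first by rewrite psiV.
- rewrite /= -edge_param_val pmap_edge /=; last first.
    by rewrite rmorph1 !mul1r; case/andP: t_in => *; rewrite !ltW.
  rewrite psiV psiE rmorph1 mul1r -piE -pmap_edge -?edge_param_val //=.
  by case/andP: t_in => *; rewrite !ltW.
- rewrite /= -leg_param_val pmap_leg /=; last by rewrite rmorph1 mul1r ltW.
  rewrite psiV psiL rmorph1 mul1r -piE -pmap_leg -?leg_param_val //=.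
  by rewrite ltW.
Qed.

(** * Projection of a superabundant curve *)

Lemma mxtrace_mul_tr (F : comNzRingType) (g n d : nat) (Y : 'M[F]_(g, n))
    (T : 'M[F]_(g, d)) (B : 'M[F]_(n, d)) :
  \tr (Y^T *m (T *m B^T)) = \tr ((Y *m B)^T *m T).
Proof. by rewrite mulmxA mxtrace_mulC mulmxA trmx_mul. Qed.

Theorem proposition1p3p2 (R : realType) (n d : nat) (Gam : tropical_curve R n)
    (phi : parametrisation Gam d) :
  superabundant phi ->
  (genus Gam < d)%N ->
  exists A : 'M[rat]_(d, genus Gam),
    (forall y : 'rV[R]_(genus Gam), exists x : 'rV[R]_d, rational_map A x = y) /\
    exists (c : dilation Gam) (psi : parametrisation (dilate c) (genus Gam)),
      (forall p : curve_point Gam, psi (dilate_point c p) = rational_map A (phi p)) /\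
      superabundant psi.
Proof.
move=> phi_sup lt_gd; have [z z_gen] := generating_cycles Gam.
have /(superabundantP _ z_gen)[X X0 trX] := phi_sup.
have [Y [B [XE rankB]]] := factor_full_rank X (ltnW lt_gd).
have [D [N [D0 NE]]] := clear_denominators_mx B^T.
have D0' : D%:~R != 0 :> rat by rewrite intr_eq0.
have [psi [psiE slopeE]] := compose_integral phi N.
exists (map_mx intr N); split.
  have /row_fullP[M MN] : row_full (map_mx intr N : 'M[rat]_(d, genus Gam)).
    by rewrite NE /row_full (eqmx_scale _ D0') mxrank_tr rankB.
  move=> y; exists (y *m map_mx ratr M).
  by rewrite /rational_map -mulmxA -map_mxM MN map_mx1 mulmx1.
exists (unit_dilation Gam), psi; split=> //.
apply/(superabundantP psi z_gen); exists Y => [|e].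
  by apply: contraNneq X0 => Y0; rewrite XE Y0 mul0mx.
have := trX e; rewrite /cycle_slope slopeE XE mulmxA [in X in _ -> X]map_mxM NE.
rewrite -scalemxAr -scalemxAr mxtraceZ => tr0.
by rewrite (etrans (mxtrace_mul_tr _ _ _) tr0) mulr0.
Qed.
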